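(* Let $A:\mathbb R\to\mathbb R^{n\times n}$ be continuous with $\sup_{t}\|A(t)\|=\mu<\infty$; let $f:\mathbb R\times\mathbb R^n\times\mathbb R^n\to\mathbb R^n$ be continuous in its first argument with $f(t,0,0)=0$ and $\|f(t,y_1,w_1)-f(t,y_2,w_2)\|\le l(\|y_1-y_2\|+\|w_1-w_2\|)$; let $x'=A(t)x$ have an exponential dichotomy on $\mathbb R$ with constants $K,\sigma>0$; and let $lM\theta[1+M(1+l\theta)e^{Ml\theta}]<m$, where $M=e^{\mu\theta}$, $m=e^{-\mu\theta}$. Fix $N>0$, $\alpha\in(0,\sigma)$ and $t_0\in\mathbb R$. A function $z(t)=(u(t),v(t))$ with $\|z(t)\|\le Ne^{-\alpha(t-t_0)}$ for $t\ge t_0$ is a solution on $\mathbb R$ of the reduced system $$u'=B_+(t)u+g_+(t,z(t),z(\beta(t))),\qquad v'=B_-(t)v+g_-(t,z(t),z(\beta(t)))$$ if and only if it is a solution on $\mathbb R$ of the system of integral equations $$u(t)=U(t,t_0)u(t_0)+\int_{t_0}^tU(t,s)g_+(s,z(s),z(\beta(s)))\,ds,\qquad v(t)=-\int_t^\infty V(t,s)g_-(s,z(s),z(\beta(s)))\,ds .$$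
   Context: $\|\cdot\|$ is the Euclidean norm and the induced operator norm. $(\theta_i)_{i\in\mathbb Z}$ is a strictly increasing real sequence with $|\theta_i|\to\infty$ as $|i|\to\infty$ and $\theta_{i+1}-\theta_i\le\theta$ for all $i$, where $\theta>0$; $\beta(t)=\theta_i$ for $\theta_i\le t<\theta_{i+1}$. Exponential dichotomy: for a fundamental matrix $X(t)$ of $x'=A(t)x$ there is a projection $P$ with $\|X(t)PX^{-1}(s)\|\le Ke^{-\sigma(t-s)}$ for $t\ge s$ and $\|X(t)(I-P)X^{-1}(s)\|\le Ke^{-\sigma(s-t)}$ for $t\le s$. Reduced system: the equation $y'=A(t)y+f(t,y(t),y(\beta(t)))$ is transformed by $y=Q(t)z$, where $Q$ is a Lyapunov matrix ($C^1$, with $Q,Q',Q^{-1}$ bounded on $\mathbb R$) block-diagonalizing $x'=A(t)x$ according to the dichotomy, into the displayed system with $z=(u,v)$, $u\in\mathbb R^k$, $v\in\mathbb R^{n-k}$, $k=\operatorname{rank}P$, $\operatorname{diag}\{B_+,B_-\}=Q^{-1}AQ-Q^{-1}Q'$ and $(g_+,g_-)(t,z,w)=Q^{-1}(t)f(t,Q(t)z,Q(\beta(t))w)$. $U(t,s)$ and $V(t,s)$ are the fundamental matrices of $u'=B_+(t)u$ and $v'=B_-(t)v$ with $U(s,s)=I$, $V(s,s)=I$; they satisfy $\|U(t,s)\|\le Ke^{-\sigma(t-s)}$ for $t\ge s$ and $\|V(t,s)\|\le Ke^{-\sigma(s-t)}$ for $t\le s$. A solution on $\mathbb R$ of the reduced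 system is a continuous function on $\mathbb R$, differentiable except possibly at the points $\theta_i$ (where the right derivative exists), satisfying the system on every $(\theta_i,\theta_{i+1})$ and with right derivatives at the $\theta_i$. *)

(* Defs.v *)
From HB Require Import structures.
From mathcomp Require Import all_boot all_order all_algebra.
From mathcomp Require Import all_classical all_reals all_analysis.

Set Implicit Arguments.
Unset Strict Implicit.
Unset Printing Implicit Defensive.

Import Order.TTheory GRing.Theory Num.Theory.
Import numFieldNormedType.Exports.

Local Open Scope classical_set_scope.
Local Open Scope ring_scope.

(* The library norm on matrices is the sup norm; the Euclidean norm and the
   operator norm it induces are therefore defined here.  Both norms give the
   same topology, so continuity and derivatives are the library's. *)
Definition enorm (R : realType) (n : nat) (x : 'cV[R]_n) : R :=
  Num.sqrt (\sum_i x i 0 ^+ 2).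

Definition opnorm (R : realType) (m n : nat) (A : 'M[R]_(m, n)) : R :=
  sup [set enorm (A *m x) | x in [set x : 'cV[R]_n | enorm x <= 1]].

Definition fundamental_matrix (R : realType) (n : nat)
    (A X : R -> 'M[R]_n) : Prop :=
  (forall t : R, X t \in unitmx) /\
  (forall t : R, is_derive t 1 X (A t *m X t)).

Definition transition_matrix (R : realType) (n : nat)
    (B : R -> 'M[R]_n) (U : R -> R -> 'M[R]_n) : Prop :=
  forall s : R, U s s = 1%:M /\
    forall t : R, is_derive t 1 (fun r => U r s) (B t *m U t s).

Definition exponential_dichotomy (R : realType) (n : nat)
    (A X : R -> 'M[R]_n) (P : 'M[R]_n) (K sigma : R) : Prop :=
  [/\ fundamental_matrix A X,
      P *m P = P,
      forall t s : R, s <= t ->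
        opnorm (X t *m P *m invmx (X s)) <= K * expR (- sigma * (t - s)) &
      forall t s : R, t <= s ->
        opnorm (X t *m (1%:M - P) *m invmx (X s))
          <= K * expR (- sigma * (s - t))].

Definition opbounded (R : realType) (n : nat) (F : R -> 'M[R]_n) : Prop :=
  exists c : R, forall t : R, opnorm (F t) <= c.

Definition lyapunov_matrix (R : realType) (n : nat) (Q : R -> 'M[R]_n) : Prop :=
  [/\ forall t : R, derivable Q t 1,
      continuous (derive1 Q),
      forall t : R, Q t \in unitmx &
      [/\ opbounded Q, opbounded (derive1 Q) & opbounded (fun t => invmx (Q t))]].

Definition switching_sequence (R : realType) (theta : R) (th : int -> R) : Prop :=
  [/\ forall i j : int, i < j -> th i < th j,
      forall C : R, exists n : nat,
        forall i : int, (n <= `|i|)%N -> C <= `|th i| &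
      forall i : int, th (i + 1) - th i <= theta].

Definition piecewise_argument (R : realType) (th : int -> R) (beta : R -> R)
    : Prop :=
  forall (i : int) (t : R), th i <= t < th (i + 1) -> beta t = th i.

Definition reduced_nonlinearity (R : realType) (n : nat) (Q : R -> 'M[R]_n)
    (beta : R -> R) (f : R -> 'cV[R]_n -> 'cV[R]_n -> 'cV[R]_n)
    (t : R) (z w : 'cV[R]_n) : 'cV[R]_n :=
  invmx (Q t) *m f t (Q t *m z) (Q (beta t) *m w).

Definition has_right_derivative (R : realType) (n : nat) (x : R -> 'cV[R]_n)
    (t : R) (d : 'cV[R]_n) : Prop :=
  (fun h : R => h^-1 *: (x (t + h) - x t)) @ 0^'+ --> d.

Definition reduced_solution (R : realType) (k p : nat) (th : int -> R)
    (beta : R -> R) (Bp : R -> 'M[R]_k) (Bm : R -> 'M[R]_p)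
    (g : R -> 'cV[R]_(k + p) -> 'cV[R]_(k + p) -> 'cV[R]_(k + p))
    (u : R -> 'cV[R]_k) (v : R -> 'cV[R]_p) : Prop :=
  let z t := col_mx (u t) (v t) in
  let du t := Bp t *m u t + usubmx (g t (z t) (z (beta t))) in
  let dv t := Bm t *m v t + dsubmx (g t (z t) (z (beta t))) in
  [/\ continuous u, continuous v,
      forall (i : int) (t : R), th i < t < th (i + 1) ->
        is_derive t 1 u (du t) /\ is_derive t 1 v (dv t) &
      forall i : int,
        has_right_derivative u (th i) (du (th i)) /\
        has_right_derivative v (th i) (dv (th i))].

Definition vintegrable (R : realType) (n : nat) (D : set R)
    (h : R -> 'cV[R]_n) : Prop :=
  forall i, (@lebesgue_measure R).-integrable D (fun s => (h s i 0)%:E).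

Definition vintegral (R : realType) (n : nat) (D : set R)
    (h : R -> 'cV[R]_n) : 'cV[R]_n :=
  \col_i (\int[@lebesgue_measure R]_(s in D) h s i 0).

Definition oriented_integral (R : realType) (n : nat) (a b : R)
    (h : R -> 'cV[R]_n) : 'cV[R]_n :=
  if a <= b then vintegral `[a, b] h else - vintegral `[b, a] h.

(* The library integral is total, so existence of the integrals is part of
   being a solution.  Continuity of u and v is not demanded: it follows from
   the equations. *)
Definition integral_solution (R : realType) (k p : nat) (beta : R -> R)
    (U : R -> R -> 'M[R]_k) (V : R -> R -> 'M[R]_p)
    (g : R -> 'cV[R]_(k + p) -> 'cV[R]_(k + p) -> 'cV[R]_(k + p)) (t0 : R)
    (u : R -> 'cV[R]_k) (v : R -> 'cV[R]_p) : Prop :=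
  let z t := col_mx (u t) (v t) in
  let hu t s := U t s *m usubmx (g s (z s) (z (beta s))) in
  let hv t s := V t s *m dsubmx (g s (z s) (z (beta s))) in
  forall t : R,
    [/\ vintegrable `[Num.min t0 t, Num.max t0 t] (hu t),
        u t = U t t0 *m u t0 + oriented_integral t0 t (hu t),
        vintegrable `[t, +oo[ (hv t) &
        v t = - vintegral `[t, +oo[ (hv t)].

(* Main.v *)
(** Since [B_+] and [B_-] have bounded entries, Gronwall's inequality makes
    linear initial value problems unique, so [U t s *m U s r = U t r], the
    transition matrices are invertible, and [dU(t,s)/ds = - U(t,s) B(s)].
    Hence the equation [x' = B x + G] off the switching times says exactly that
    [s |-> U t s *m x s] is a primitive of [s |-> U t s *m G s], where [G] is
    continuous on each [[th i, th (i + 1)[].  Integrating from [t0] to [t] gives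
    the equation for [u].  For [v] one integrates from [t] to [T] and lets
    [T -> +oo]: [V t T *m v T] and the tail of the integral decay like
    [exp (- sigma (T - t))], because [z], hence [G], is bounded on a half-line.
    Conversely, the integral equations say that [U t0 s *m u s] and
    [V t0 s *m v s] are primitives; this gives continuity first, then
    continuity of [G] on the pieces, and then differentiability. *)

Require Import Defs.
From HB Require Import structures.
From mathcomp Require Import all_boot all_order all_algebra.
From mathcomp Require Import all_classical all_reals all_analysis.
From mathcomp Require Import measurable_realfun ring lra.

Set Implicit Arguments.
Unset Strict Implicit.
Unset Printing Implicit Defensive.

Import Order.TTheory GRing.Theory Num.Theory.
Import numFieldNormedType.Exports.

Local Open Scope classical_set_scope.
Local Open Scope ring_scope.

(** * Entrywise limits and derivatives of matrix-valued functions *)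

Lemma cvg_mxP (T : Type) (F : set_system T) (FF : Filter F)
    (R : realType) (m n : nat) (f : T -> 'M[R]_(m, n)) (M : 'M[R]_(m, n)) :
  f @ F --> M <-> forall i j, (fun x => f x i j) @ F --> M i j.
Proof.
split=> [fM i j A nA|fM A [P nP PA]].
  have : nbhs M [set N : 'M[R]_(m, n) | A (N i j)].
    (* A box that constrains only the entry at [(i, j)] is a matrix neighbourhood. *)
    exists (fun i' j' => if (i' == i) && (j' == j) then A else setT).
      move=> i' j'; case: ifP => [/andP[/eqP-> /eqP->]//|_]; exact: filterT.
    by move=> N /(_ i j); rewrite !eqxx.
  by move=> /fM.
rewrite /= nbhs_simpl /=.
apply: (filterS (P := [set x | forall i j, P i j (f x i j)])).
  by move=> x Px; apply: PA.
apply: filter_forall => i; apply: filter_forall => j.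
exact: (fM i j _ (nP i j)).
Qed.

Lemma cvg_mulmx (T : Type) (F : set_system T) (FF : Filter F)
    (R : realType) (m n q : nat) (f : T -> 'M[R]_(m, n)) (g : T -> 'M[R]_(n, q))
    (M : 'M[R]_(m, n)) (N : 'M[R]_(n, q)) :
  f @ F --> M -> g @ F --> N -> (fun x => f x *m g x) @ F --> M *m N.
Proof.
move=> /cvg_mxP fM /cvg_mxP gN; apply/cvg_mxP => i j; rewrite !mxE.
under eq_cvg do rewrite mxE.
apply: cvg_big => [|k _]; first exact: add_continuous.
exact: cvgM (fM i k) (gN k j).
Qed.

Lemma cvg_det (T : Type) (F : set_system T) (FF : Filter F)
    (R : realType) (n : nat) (f : T -> 'M[R]_n) (M : 'M[R]_n) :
  f @ F --> M -> (fun x => \det (f x)) @ F --> \det M.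
Proof.
move=> /cvg_mxP fM; rewrite /determinant.
apply: cvg_big => [|s _]; first exact: add_continuous.
apply: cvgM; first exact: cvg_cst.
apply: cvg_big => [|i _]; first exact: mul_continuous.
exact: fM.
Qed.

(** By the adjugate formula the entries of the inverse are cofactors divided by the determinant,
    hence continuous where the determinant does not vanish. *)
Lemma cvg_invmx (T : Type) (F : set_system T) (FF : Filter F)
    (R : realType) (n : nat) (f : T -> 'M[R]_n) (M : 'M[R]_n) :
  (forall x, f x \in unitmx) -> M \in unitmx ->
  f @ F --> M -> (fun x => invmx (f x)) @ F --> invmx M.
Proof.
move=> uf uM fM; apply/cvg_mxP => i j.
rewrite /invmx uM !mxE; under eq_cvg do rewrite uf !mxE.
apply: cvgM.
  by apply: cvgV; [move: uM; rewrite unitmxE unitfE|exact: cvg_det].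
apply: cvgM; first exact: cvg_cst.
apply: cvg_det; apply/cvg_mxP => k l; rewrite !mxE.
under eq_cvg do rewrite !mxE.
by move/cvg_mxP : fM; apply.
Qed.

Definition diff_quot (R : realType) (m n : nat) (f : R -> 'M[R]_(m, n))
  (t h : R) : 'M[R]_(m, n) := h^-1 *: (f (t + h) - f t).

Lemma is_derive_diff_quot (R : realType) (m n : nat) (f : R -> 'M[R]_(m, n))
    (t : R) (D : 'M[R]_(m, n)) :
  is_derive t 1 f D <-> diff_quot f t @ 0^' --> D.
Proof.
have E : (fun h : R => h^-1 *: ((f \o shift t) (h *: 1) - f t)) = diff_quot f t.
  apply/funext => h; rewrite /diff_quot /=.
  by rewrite [h *: 1]mulr1 [h + t]addrC.
split=> [[df <-]|fD].
  by move: df; rewrite /derivable /derive E.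
split; first by apply/cvg_ex; exists D; rewrite E.
by rewrite /derive E; apply/cvg_lim.
Qed.

Lemma is_derive_mxP (R : realType) (m n : nat) (f : R -> 'M[R]_(m, n))
    (t : R) (D : 'M[R]_(m, n)) :
  is_derive t 1 f D <-> forall i j, is_derive t 1 (fun r => f r i j) (D i j).
Proof.
have E i j : (fun h : R => h^-1 *: (((fun r => f r i j) \o shift t) (h *: 1) - f t i j))
   = (fun h => diff_quot f t h i j).
  apply/funext => h; rewrite /diff_quot /= !mxE.
  by rewrite [h *: 1]mulr1 [h + t]addrC.
split=> [/is_derive_diff_quot/cvg_mxP fD i j|fD].
  split; first by apply/cvg_ex; exists (D i j); rewrite E; exact: fD.
  by rewrite /derive E; apply/cvg_lim => //; exact: fD.
apply/is_derive_diff_quot/cvg_mxP => i j.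
have [+ <-] := fD i j; by rewrite /derivable /derive E.
Qed.

(** The usual splitting of the increment of a product. The filter is left free so that one proof
    serves two-sided derivatives ([0^']) and right derivatives ([0^'+]). *)
Lemma diff_quot_mulmx (R : realType) (m n q : nat) (F : set_system R) (FF : Filter F)
    (f : R -> 'M[R]_(m, n)) (g : R -> 'M[R]_(n, q)) (t : R)
    (Df : 'M[R]_(m, n)) (Dg : 'M[R]_(n, q)) :
  F --> (0 : R) -> {for t, continuous g} ->
  diff_quot f t @ F --> Df -> diff_quot g t @ F --> Dg ->
  diff_quot (fun r => f r *m g r) t @ F --> Df *m g t + f t *m Dg.
Proof.
move=> F0 gt fD gD.
have -> : diff_quot (fun r => f r *m g r) t =
    (fun h => diff_quot f t h *m g (t + h) + f t *m diff_quot g t h).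
  apply/funext => h; rewrite /diff_quot -scalemxAl -scalemxAr -scalerDr.
  by rewrite mulmxBl mulmxBr addrA subrK.
apply: cvgD; apply: cvg_mulmx => //; last exact: cvg_cst.
apply: continuous_cvg => //; rewrite -[X in _ --> X]addr0.
by apply: cvgD => //; exact: cvg_cst.
Qed.

Lemma is_derive_mx_continuous (R : realType) (m n : nat) (f : R -> 'M[R]_(m, n))
    (t : R) (D : 'M[R]_(m, n)) : is_derive t 1 f D -> {for t, continuous f}.
Proof.
by case=> df _; apply/differentiable_continuous/derivable1_diffP.
Qed.

Lemma is_derive_mulmx (R : realType) (m n q : nat)
    (f : R -> 'M[R]_(m, n)) (g : R -> 'M[R]_(n, q)) (t : R)
    (Df : 'M[R]_(m, n)) (Dg : 'M[R]_(n, q)) :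
  is_derive t 1 f Df -> is_derive t 1 g Dg ->
  is_derive t 1 (fun r => f r *m g r) (Df *m g t + f t *m Dg).
Proof.
move=> fD gD; apply/is_derive_diff_quot; apply: diff_quot_mulmx.
- exact: cvg_within.
- exact: is_derive_mx_continuous gD.
- exact/is_derive_diff_quot.
- exact/is_derive_diff_quot.
Qed.

Lemma is_derive_invmx (R : realType) (n : nat) (f : R -> 'M[R]_n) (t : R)
    (D : 'M[R]_n) :
  (forall r, f r \in unitmx) -> is_derive t 1 f D ->
  is_derive t 1 (fun r => invmx (f r)) (- (invmx (f t) *m D *m invmx (f t))).
Proof.
move=> uf fD; apply/is_derive_diff_quot.
have ct := is_derive_mx_continuous fD.
(* Resolvent identity: the increment of the inverse is minus the inverse at [t + h], times the
   increment of [f], times the inverse at [t]. *)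
have -> : diff_quot (fun r => invmx (f r)) t =
    (fun h => - (invmx (f (t + h)) *m diff_quot f t h *m invmx (f t))).
  apply/funext => h; rewrite /diff_quot -scalemxAr -scalemxAl -scalerN; congr (_ *: _).
  by rewrite mulmxBr mulVmx// mulmxBl mul1mx -mulmxA mulmxV// mulmx1 opprB.
apply: cvgN; apply: cvg_mulmx; last exact: cvg_cst.
apply: cvg_mulmx; last exact/is_derive_diff_quot.
apply: cvg_invmx => //.
apply: continuous_cvg => //; rewrite -[X in _ --> X]addr0.
by apply: cvgD; [exact: cvg_cst|exact: cvg_within].
Qed.

(** * Integrals over compact intervals and primitives *)

Definition interval_integral (R : realType) (h : R -> R) (a b c : R) : Prop :=
  (@lebesgue_measure R).-integrable `[a, b] (fun s => (h s)%:E) /\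
  \int[@lebesgue_measure R]_(s in `[a, b]) h s = c.

(** The integrated form of [G' = h], which tolerates jumps of [h]. It is the middle ground between
    the differential and the integral equations: each is translated into it and recovered from
    it. *)
Definition has_primitive (R : realType) (h G : R -> R) : Prop :=
  forall a b, a <= b -> interval_integral h a b (G b - G a).

Lemma integrable_setU (d : measure_display) (T : measurableType d) (R : realType)
    (mu : {measure set T -> \bar R}) (A B : set T) (h : T -> \bar R) :
  measurable A -> measurable B ->
  mu.-integrable A h -> mu.-integrable B h -> mu.-integrable (A `|` B) h.
Proof.
move=> mA mB /integrableP[mhA iA] /integrableP[mhB iB].
have mh : measurable_fun (A `|` B) h by apply/measurable_funU.
apply/integrableP; split=> //.
have E : A `|` B = A `|` (B `\` A) by rewrite setUDr setDv setD0.
rewrite E ge0_integral_setU//=.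
- apply: lte_add_pinfty => //.
  apply: le_lt_trans iB; apply: ge0_subset_integral => //.
  + exact: measurableD.
  + exact: measurableT_comp.
- exact: measurableD.
- by rewrite -E; exact: measurableT_comp.
- by apply/disj_setPS => x [Ax []].
Qed.

Lemma interval_integral1 (R : realType) (h : R -> R) (a : R) :
  interval_integral h a a 0.
Proof.
split; last by rewrite set_itv1 Rintegral_set1.
apply: (@eq_integrable _ _ _ _ _ _ (EFin \o (fun=> h a))) => //.
  by move=> x; rewrite set_itv1 inE /= => ->.
apply: continuous_compact_integrable; first exact: segment_compact.
by apply: continuous_subspaceT => x; exact: cvg_cst.
Qed.

Lemma interval_integral_cat (R : realType) (h : R -> R) (a b c x y : R) :
  a <= b -> b <= c -> interval_integral h a b x -> interval_integral h b c y ->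
  interval_integral h a c (x + y).
Proof.
move=> ab bc [iab eab] [ibc ebc].
have E : `[a, c]%classic = `[a, b]%classic `|` `[b, c]%classic :> set R.
  apply/seteqP; split=> t /=; rewrite !in_itv/=.
    by move=> /andP[-> ->]; rewrite andbT; exact/orP/le_total.
  by case=> /andP[l r]; [rewrite l (le_trans r)|rewrite (le_trans ab)].
have iac : (@lebesgue_measure R).-integrable `[a, c] (fun s => (h s)%:E).
  by rewrite E; exact: integrable_setU.
split=> //.
have := @Rintegral_itvB _ h (BLeft a) (BRight c) b iac.
rewrite !bnd_simp => /(_ ab bc) /eqP.
rewrite Rintegral_itv_obnd_cbnd; last first.
  apply: integrableS ibc => //; exact: subset_itv_oc_cc.
by rewrite eab ebc subr_eq addrC => /eqP.
Qed.

(** On a piece between switching times [h] agrees with a continuous [phi] except perhaps at the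
    right end, where the delayed argument jumps. A single point is null, so the fundamental theorem
    for [phi] carries over to [h]. *)
Lemma interval_integral_FTC (R : realType) (h phi F : R -> R) (a b : R) :
  a <= b -> continuous phi -> continuous F ->
  {in `[a, b[, h =1 phi} ->
  (forall t, a < t < b -> is_derive t 1 F (phi t)) ->
  interval_integral h a b (F b - F a).
Proof.
rewrite le_eqVlt => /predU1P[<- *|ab cphi cF hphi dF].
  rewrite subrr; exact: interval_integral1.
have iphi : (@lebesgue_measure R).-integrable `[a, b] (EFin \o phi).
  apply: continuous_compact_integrable; first exact: segment_compact.
  exact: continuous_subspaceT.
have sub : `[a, b[%classic `<=` (`[a, b] : set R) by exact: subset_itv_co_cc.
have iphio : (@lebesgue_measure R).-integrable `[a, b[ (EFin \o phi).
  exact: integrableS iphi.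
have iho : (@lebesgue_measure R).-integrable `[a, b[ (EFin \o h).
  apply: eq_integrable iphio => //.
  by move=> x; rewrite inE /= => xab; rewrite hphi.
split.
  rewrite -(@setUitv1 _ _ (BLeft a) b true) ?bnd_simp ?ltW//.
  apply: integrable_setU => //.
  by have [] := interval_integral1 h b; rewrite set_itv1.
rewrite -Rintegral_itv_bndo_bndc//.
have -> : \int[@lebesgue_measure R]_(s in `[a, b[) h s =
    \int[@lebesgue_measure R]_(s in `[a, b[) phi s.
  apply: eq_Rintegral.
  by move=> x; rewrite inE /= => xab; rewrite hphi.
rewrite Rintegral_itv_bndo_bndc// /Rintegral.
rewrite (@continuous_FTC2 _ phi F)//; first exact: continuous_subspaceT.
- split.
  + by move=> x; rewrite in_itv/= => /dF [].
  + exact/cvg_at_right_filter/cF.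
  + exact/cvg_at_left_filter/cF.
- by move=> x; rewrite in_itv/= derive1E => /dF [].
Qed.

(** Near [x], [G] is a constant plus the integral of [h] from [x - 1], and an integral depends
    continuously on its upper limit. *)
Lemma has_primitive_continuous (R : realType) (h G : R -> R) :
  has_primitive h G -> continuous G.
Proof.
move=> hG x.
have [ih _] := hG (x - 1) (x + 1) ltac:(lra).
have := @parameterized_integral_continuous R (x - 1) (x + 1) h ltac:(lra) ih.
move=> /continuous_within_itvP -/(_ ltac:(lra)) [+ _ _] => /(_ x).
rewrite in_itv/= => /(_ ltac:(lra)) cx.
pose H y := G (x - 1) + parameterized_integral lebesgue_measure (x - 1) y h.
have HE y : x - 1 <= y -> H y = G y.
  move=> xy; rewrite /H /parameterized_integral.
  by have [_ ->] := hG (x - 1) y xy; rewrite addrC subrK.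
have cH : H y @[y --> x] --> G x.
  rewrite -HE; last lra.
  by apply: cvgD => //; exact: cvg_cst.
apply: cvg_trans cH; apply: near_eq_cvg; near=> y.
apply: HE; apply/ltW; near: y; apply: lt_nbhsr; lra.
Unshelve. all: by end_near. Qed.


Lemma continuous_interval_integral (R : realType) (phi : R -> R) (a b : R) :
  continuous phi ->
  interval_integral phi a b (\int[@lebesgue_measure R]_(s in `[a, b]) phi s).
Proof.
move=> cphi; split=> //.
apply: continuous_compact_integrable; first exact: segment_compact.
exact: continuous_subspaceT.
Qed.

(** Integrating the globally continuous [phi] instead of [h] yields a function with a two-sided
    derivative even at the left end [c], where [G] itself may have a corner. *)
Lemma has_primitive_locally_antiderivative (R : realType) (h phi G : R -> R)
    (c d : R) :
  has_primitive h G -> continuous phi -> {in `[c, d[, h =1 phi} ->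
  exists2 Phi : R -> R, (forall x, c <= x < d -> is_derive x 1 Phi (phi x)) &
    {in `[c, d[, G =1 Phi}.
Proof.
move=> hG cphi hphi.
(* Starting at [c - 1] makes [c] an interior point of the interval of integration. *)
pose I x := \int[@lebesgue_measure R]_(s in `[c - 1, x]) phi s.
have dI x : c <= x < d -> is_derive x 1 I (phi x).
  move=> /andP[cx xd].
  have [ip _] := continuous_interval_integral (c - 1) d cphi.
  have [||dI eI] := @continuous_FTC1_closed _ phi (c - 1) x d xd ip.
  - lra.
  - exact: cphi.
  - by apply: DeriveDef => //; rewrite -derive1E.
have c1c : c - 1 <= c by rewrite gerBl.
exists (fun x => G c - I c + I x) => [x cxd|x].
  have := dI x cxd => dIx.
  rewrite -[phi x]add0r.
  exact: (@is_deriveD _ _ _ (cst (G c - I c)) I).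
rewrite in_itv/= => /andP[cx xd].
have [_ e1] := hG c x cx.
have e2 : \int[@lebesgue_measure R]_(s in `[c, x]) h s =
    \int[@lebesgue_measure R]_(s in `[c, x]) phi s.
  apply: eq_Rintegral => s; rewrite inE/= in_itv/= => /andP[cs sx].
  by apply: hphi; rewrite in_itv/= cs (le_lt_trans sx).
have [_ e3] := interval_integral_cat c1c cx
  (continuous_interval_integral (c - 1) c cphi) (continuous_interval_integral c x cphi).
by rewrite /I e3 addrA subrK -e2 e1 addrC subrK.
Qed.

Lemma has_primitive_derive (R : realType) (h phi G : R -> R) (c d t : R) :
  has_primitive h G -> continuous phi -> {in `[c, d[, h =1 phi} ->
  c < t < d -> is_derive t 1 G (phi t).
Proof.
move=> hG cphi hphi /andP[ct td].
have [Phi dPhi GPhi] := has_primitive_locally_antiderivative hG cphi hphi.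
have dt : is_derive t 1 Phi (phi t) by apply: dPhi; rewrite (ltW ct).
apply: near_eq_is_derive dt; near=> y.
rewrite GPhi// in_itv/=; apply/andP; split; first (apply/ltW; near: y; exact: lt_nbhsr).
near: y; exact: lt_nbhsl.
Unshelve. all: by end_near. Qed.

(** To the right of [c], [G] coincides with an antiderivative of [phi] that is differentiable at
    [c], so the one-sided quotients have the same limit. *)
Lemma has_primitive_right_derive (R : realType) (h phi G : R -> R) (c d : R) :
  has_primitive h G -> continuous phi -> {in `[c, d[, h =1 phi} -> c < d ->
  e^-1 * (G (c + e) - G c) @[e --> 0^'+] --> phi c.
Proof.
move=> hG cphi hphi cd.
have [Phi dPhi GPhi] := has_primitive_locally_antiderivative hG cphi hphi.
have [dc ec] : is_derive c 1 Phi (phi c) by apply: dPhi; rewrite lexx.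
rewrite -ec /derive.
have : e^-1 * (Phi (c + e) - Phi c) @[e --> 0^'+] --> 'D_1 Phi c.
  apply: (@cvg_trans _ (e^-1 *: ((Phi \o shift c) (e *: 1) - Phi c) @[e --> 0^'+])).
    apply: near_eq_cvg; near=> e.
    by rewrite /= [e *: 1]mulr1 [c + e]addrC.
  exact: cvg_dnbhs_at_right dc.
apply: cvg_trans; apply: near_eq_cvg; near=> e.
rewrite !GPhi// in_itv/= ?lexx//.
have e0 : 0 < e by [].
rewrite lerDl (ltW e0)/= -ltrBrDl.
near: e; apply: nbhs_right_lt; lra.
Unshelve. all: by end_near. Qed.

(** * Switching sequences and gluing along their pieces *)

Lemma switching_sequence_unbounded (R : realType) (theta : R) (th : int -> R)
    (C : R) :
  switching_sequence theta th -> exists n : nat, th (- n%:Z) <= - C /\ C <= th n%:Z.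
Proof.
move=> [mono unb _].
pose D := `|C| + `|th 0| + 1.
have CD : C <= D.
  by rewrite /D (le_trans (ler_norm C))// -addrA lerDl addr_ge0.
have th0D : `|th 0| < D.
  by rewrite /D -addrA addrCA ltrDl ltr_wpDl.
have [n hn] := unb D.
exists n.+1.
have gt0 : th 0 < th n.+1%:Z by exact: mono.
have lt0 : th (- n.+1%:Z) < th 0 by apply: mono; rewrite oppr_lt0.
have h1 : D <= `|th n.+1%:Z| by apply: hn; rewrite absz_nat.
have h2 : D <= `|th (- n.+1%:Z)| by apply: hn; rewrite abszN absz_nat.
move: th0D; rewrite ltr_norml => /andP[l r].
move: h1 h2; rewrite !ler_normr => /orP h1 /orP h2.
split; [case: h2 => h2; lra|case: h1 => h1; lra].
Qed.

Lemma switching_sequence_locate (R : realType) (theta : R) (th : int -> R)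
    (t : R) :
  switching_sequence theta th -> exists i : int, th i <= t < th (i + 1).
Proof.
move=> hth; have [mono _ _] := hth.
have [n [lo hi]] := switching_sequence_unbounded (`|t| + 1) hth.
have lo' : th (- n%:Z) <= t.
  by apply: le_trans lo _; rewrite lerNl (le_trans (ler_norm _))// normrN lerDl.
have {}hi : t < th (- n%:Z + (n + n)%:Z).
  rewrite PoszD addKr; apply: lt_le_trans hi.
  by rewrite (le_lt_trans (ler_norm t))// ltrDl.
(* Descend from an upper switching time beyond [t]; the first one not exceeding [t] is the left end
   sought, and [lo'] guarantees that it is met. *)
move: (n + n)%N hi => k; elim: k => [|k IH] hi.
  by rewrite addr0 in hi; move: (le_lt_trans lo' hi); rewrite ltxx.
have [/IH//|kt] := ltP t (th (- n%:Z + k%:Z)).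
by exists (- n%:Z + k%:Z); rewrite kt/= -addrA -[1]/(1%:Z) -PoszD addn1.
Qed.

(** A compact interval meets only finitely many pieces; the fundamental theorem holds on each, and
    continuity of [F] lets the increments telescope. *)
Lemma piecewise_has_primitive (R : realType) (theta : R) (th : int -> R)
    (h F : R -> R) (phi : int -> R -> R) :
  switching_sequence theta th -> continuous F ->
  (forall i, continuous (phi i)) ->
  (forall i, {in `[th i, th (i + 1)[, h =1 phi i}) ->
  (forall i t, th i < t < th (i + 1) -> is_derive t 1 F (phi i t)) ->
  has_primitive h F.
Proof.
move=> hth cF cphi hphi dF a b ab.
have piece i x y : th i <= x -> x <= y -> y <= th (i + 1) ->
    interval_integral h x y (F y - F x).
  move=> ix xy yi; apply: (interval_integral_FTC (phi := phi i)) => //.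
  - move=> s; rewrite in_itv/= => /andP[xs sy]; apply: hphi.
    by rewrite in_itv/= (le_trans ix xs) (lt_le_trans sy yi).
  - move=> s /andP[xs sy]; apply: dF.
    by rewrite (le_lt_trans ix xs) (lt_le_trans sy yi).
(* Induction on the number [n] of pieces that cover [[x, y]], splitting off the last one. *)
have many i n x y : th i <= x -> x <= y -> y <= th (i + n%:Z) ->
    interval_integral h x y (F y - F x).
  elim: n x y => [|n IH] x y ix xy yn.
    have -> : x = y by apply/le_anti; rewrite xy/= (le_trans _ ix)//; rewrite addr0 in yn.
    by rewrite subrr; exact: interval_integral1.
  have [yn'|/ltW yn'] := leP y (th (i + n%:Z)); first exact: IH.
  have yn1 : y <= th (i + n%:Z + 1) by rewrite -addrA -[1]/(1%:Z) -PoszD addn1.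
  have [/ltW xn|nx] := ltP x (th (i + n%:Z)); last exact: (piece (i + n%:Z)).
  have -> : F y - F x = F (th (i + n%:Z)) - F x + (F y - F (th (i + n%:Z))).
    by ring.
  apply: (interval_integral_cat xn yn'); first exact: IH.
  exact: (piece (i + n%:Z)).
have [n [lo hi]] := switching_sequence_unbounded (`|a| + `|b|) hth.
apply: (many (- n%:Z) (n + n)%N) => //.
  apply: le_trans lo _; rewrite lerNl (le_trans (ler_norm _))// normrN lerDl//.
rewrite PoszD addKr; apply: le_trans hi.
by rewrite (le_trans (ler_norm b))// lerDr.
Qed.

(** * Exponentially decaying tails *)

Lemma cvg_exponential_decay (R : realType) (sigma t : R) :
  0 < sigma -> expR (- sigma * (x - t)) @[x --> +oo] --> 0.
Proof.
move=> s0; have : expR (- (sigma * (x - t))) @[x --> +oo] --> 0.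
  apply: cvg_comp (@cvgr_expR R).
  apply/cvgryPge => A; near=> x.
  rewrite -ler_pdivrMl// lerBrDr; near: x; apply: nbhs_pinfty_ge; exact: num_real.
by under eq_cvg do rewrite -mulNr.
Unshelve. all: by end_near. Qed.

(** Domination by the exponential [g], whose primitive [F] is explicit and vanishes at infinity; the
    integral of [g] over the tail is exactly the stated bound. *)
Lemma Rintegral_exponential_tail (R : realType) (h : R -> R) (C sigma t T : R) :
  0 < sigma ->
  (forall b, (@lebesgue_measure R).-integrable `[T, b] (fun s => (h s)%:E)) ->
  (forall s, T <= s -> `|h s| <= C * expR (- sigma * (s - t))) ->
  (@lebesgue_measure R).-integrable `[T, +oo[ (fun s => (h s)%:E) /\
  `|\int[@lebesgue_measure R]_(s in `[T, +oo[) h s|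
    <= C / sigma * expR (- sigma * (T - t)).
Proof.
move=> s0 ih bh.
pose g s := C * expR (- sigma * (s - t)).
pose F s := - (C / sigma) * expR (- sigma * (s - t)).
have C0 : 0 <= C.
  by have := le_trans (normr_ge0 _) (bh T (lexx T)); rewrite pmulr_lge0// expR_gt0.
have dlin (s : R) : is_derive s (1 : R) (fun r : R => - sigma * (r - t)) (- sigma).
  have := is_deriveZ (- sigma) (is_deriveB (is_derive_id s (1 : R)) (is_derive_cst t s 1)).
  by rewrite subr0 [_ *: 1]mulr1.
have dE (s : R) : is_derive s (1 : R) (fun r => expR (- sigma * (r - t)))
    (expR (- sigma * (s - t)) * - sigma).
  exact: (@is_derive1_comp _ (@expR R) (fun r => - sigma * (r - t))).
have dF (s : R) : is_derive s (1 : R) F (g s).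
  have := is_deriveZ (- (C / sigma)) (dE s).
  have -> // : - (C / sigma) *: (expR (- sigma * (s - t)) * - sigma) = g s.
  by rewrite [_ *: _]mulrCA mulrC mulrNN divfK// gt_eqF.
have cont (f f' : R -> R) : (forall s, is_derive s (1 : R) f (f' s)) -> continuous f.
  by move=> df s; apply/differentiable_continuous/derivable1_diffP; case: (df s).
have cg : continuous g.
  by move=> s; apply: cvgM; [exact: cvg_cst|exact: (cont _ _ dE s)].
have g0 s : 0 <= g s by rewrite mulr_ge0// expR_ge0.
have limF : F x @[x --> +oo] --> 0.
  rewrite -[X in _ --> X](mulr0 (- (C / sigma))).
  apply: cvgM; first exact: cvg_cst.
  exact: cvg_exponential_decay.
have eg : (\int[@lebesgue_measure R]_(s in `[T, +oo[) (g s)%:E = 0%:E - (F T)%:E)%E.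
  apply: ge0_continuous_FTC2y => //.
  - exact: continuous_subspaceT.
  - exact/cvg_at_right_filter/(cont _ _ dF).
  - by move=> x _; rewrite derive1E; case: (dF x).
have mg : measurable_fun (`[T, +oo[ : set R) g.
  by apply: measurable_funTS; exact: continuous_measurable_fun.
have ig : (@lebesgue_measure R).-integrable `[T, +oo[ (EFin \o g).
  apply/integrableP; split; first exact/measurable_EFinP.
  under eq_integral do rewrite /= ger0_norm//.
  by rewrite eg -EFinB ltry.
(* The half-line is a countable union of the intervals [[T, T + n]], on each of which integrability
   gives measurability. *)
have mh : measurable_fun (`[T, +oo[ : set R) h.
  have -> : `[T, +oo[%classic = \bigcup_(n : nat) (`[T, T + n%:R]%classic) :> set R.
    by rewrite itv_bndy_bigcup_BRight.
  apply/measurable_fun_bigcup => // n.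
  by apply/measurable_EFinP; have /integrableP[] := ih (T + n%:R).
have ihT : (@lebesgue_measure R).-integrable `[T, +oo[ (fun s => (h s)%:E).
  apply: le_integrable ig => //.
    exact/measurable_EFinP.
  move=> s /=; rewrite in_itv/= andbT => Ts; rewrite lee_fin.
  by rewrite [leRHS]ger0_norm// bh.
split=> //.
apply: le_trans (le_normr_Rintegral _ ihT) _ => //.
have -> : C / sigma * expR (- sigma * (T - t)) =
    \int[@lebesgue_measure R]_(s in `[T, +oo[) g s.
  by rewrite /Rintegral eg -EFinB/= sub0r [X in _ = - X]mulNr opprK.
apply: le_Rintegral => //.
  by have := integrable_abse ihT.
by move=> s /=; rewrite in_itv/= andbT; exact: bh.
Qed.

(** * From Euclidean and operator norms to entrywise bounds *)

Lemma normr_le_enorm (R : realType) (n : nat) (x : 'cV[R]_n) (i : 'I_n) :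
  `|x i 0| <= enorm x.
Proof.
rewrite -sqrtr_sqr; apply: ler_wsqrtr.
rewrite (bigD1 i)//= lerDl; apply: sumr_ge0 => j _; exact: sqr_ge0.
Qed.

Lemma enorm_le_sum (R : realType) (n : nat) (x : 'cV[R]_n) :
  enorm x <= \sum_i `|x i 0|.
Proof.
have s0 : 0 <= \sum_i `|x i 0| by apply: sumr_ge0.
rewrite -(ger0_norm s0) -sqrtr_sqr; apply: ler_wsqrtr.
rewrite expr2 mulr_suml; apply: ler_sum => i _.
rewrite -real_normK ?num_real// expr2; apply: ler_wpM2l => //.
by rewrite (bigD1 i)//= lerDl; apply: sumr_ge0.
Qed.

Lemma normr_le_opnorm (R : realType) (m n : nat) (A : 'M[R]_(m, n)) i j :
  `|A i j| <= opnorm A.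
Proof.
have e1 : enorm (delta_mx j 0 : 'cV[R]_n) = 1.
  rewrite /enorm (bigD1 j)//= big1 ?addr0; last first.
    by move=> k /negbTE kj; rewrite mxE kj/= expr0n.
  by rewrite mxE !eqxx expr1n sqrtr1.
have -> : A i j = (A *m delta_mx j 0 : 'cV[R]_m) i 0.
  rewrite mxE (bigD1 j)//= big1 ?addr0; last first.
    by move=> k /negbTE kj; rewrite mxE kj mulr0.
  by rewrite mxE !eqxx mulr1.
apply: le_trans (normr_le_enorm _ i) _.
apply: ub_le_sup; last by exists (delta_mx j 0) => //=; rewrite e1.
(* The supremum dominates its members only if the set is bounded above; the sum of the absolute
   entries is such a bound on the unit ball. *)
exists (\sum_i \sum_j `|A i j|) => _ [x /= x1 <-].
apply: le_trans (enorm_le_sum _) _; apply: ler_sum => k _.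
rewrite mxE; apply: le_trans (ler_norm_sum _ _ _) _; apply: ler_sum => r _.
rewrite normrM ler_piMr//; exact: le_trans (normr_le_enorm _ _) x1.
Qed.

(** Only the existence of bounds matters below, and the entrywise form passes directly to products,
    differences and blocks. *)
Definition mx_bounded (R : realType) (m n : nat) (D : set R)
    (F : R -> 'M[R]_(m, n)) : Prop :=
  exists c, forall t, D t -> forall i j, `|F t i j| <= c.

Lemma opnorm_mx_bounded (R : realType) (m n : nat) (D : set R)
    (F : R -> 'M[R]_(m, n)) (c : R) :
  (forall t, D t -> opnorm (F t) <= c) -> mx_bounded D F.
Proof.
by move=> Fc; exists c => t Dt i j; exact: le_trans (normr_le_opnorm _ _ _) (Fc t Dt).
Qed.

Lemma mx_boundedM (R : realType) (m n q : nat) (D : set R)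
    (F : R -> 'M[R]_(m, n)) (G : R -> 'M[R]_(n, q)) :
  mx_bounded D F -> mx_bounded D G -> mx_bounded D (fun t => F t *m G t).
Proof.
move=> [a Fa] [b Gb]; exists (\sum_(i < n) `|a| * `|b|) => t Dt i j.
rewrite mxE; apply: le_trans (ler_norm_sum _ _ _) _; apply: ler_sum => k _.
rewrite normrM; apply: ler_pM => //.
  exact: le_trans (Fa t Dt i k) (ler_norm a).
exact: le_trans (Gb t Dt k j) (ler_norm b).
Qed.

Lemma mx_boundedB (R : realType) (m n : nat) (D : set R)
    (F G : R -> 'M[R]_(m, n)) :
  mx_bounded D F -> mx_bounded D G -> mx_bounded D (fun t => F t - G t).
Proof.
move=> [a Fa] [b Gb]; exists (a + b) => t Dt i j.
by rewrite !mxE (le_trans (ler_normB _ _))// lerD ?Fa ?Gb.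
Qed.

(** * Uniqueness for linear equations and transition matrices *)

Lemma gronwall_eq0 (R : realType) (E E' : R -> R) (L r : R) :
  (forall t, is_derive t (1 : R) E (E' t)) -> (forall t, 0 <= E t) ->
  (forall t, `|E' t| <= L * E t) -> E r = 0 -> forall t, E t = 0.
Proof.
move=> dE E0 LE Er t.
(* Integrating factor: [G (- L)] is nonincreasing and [G L] nondecreasing. The first forces [E] to
   vanish after [r], the second before [r]. *)
pose G (a s : R) := expR (a * s) * E s.
have dG a (s : R) : is_derive s (1 : R) (G a) (expR (a * s) * (E' s + a * E s)).
  have dl : is_derive s (1 : R) (fun r => a * r) a.
    by have := is_deriveZ a (is_derive_id s (1 : R)); rewrite [_ *: 1]mulr1.
  have de : is_derive s (1 : R) (fun r => expR (a * r)) (expR (a * s) * a).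
    exact: (@is_derive1_comp _ (@expR R) (fun r => a * r)).
  have := is_deriveM de (dE s).
  have -> // : expR (a * s) *: E' s + E s *: (expR (a * s) * a) =
    expR (a * s) * (E' s + a * E s).
  by rewrite /GRing.scale/=; ring.
have cG a : continuous (G a).
  by move=> s; apply/differentiable_continuous/derivable1_diffP; case: (dG a s).
have Gle a s s' : s <= s' -> (forall y, E' y + a * E y <= 0) -> G a s' <= G a s.
  move=> ss' na.
  apply: (@ler0_derive1_le_cc _ (G a) s s') => //.
  - move=> y _; rewrite derive1E; have [_ ->] := dG a y.
    by rewrite pmulr_rle0 ?expR_gt0.
  - exact: continuous_subspaceT.
  - by rewrite in_itv/= ss' lexx.
  - by rewrite in_itv/= ss' lexx.
have Gge a s s' : s <= s' -> (forall y, 0 <= E' y + a * E y) -> G a s <= G a s'.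
  move=> ss' na.
  apply: (@ger0_derive1_le_cc _ (G a) s s') => //.
  - move=> y _; rewrite derive1E; have [_ ->] := dG a y.
    by rewrite mulr_ge0 ?expR_ge0.
  - exact: continuous_subspaceT.
  - by rewrite in_itv/= ss' lexx.
  - by rewrite in_itv/= ss' lexx.
have done a : G a t <= G a r -> E t = 0.
  rewrite /G Er mulr0 pmulr_rle0 ?expR_gt0// => Et.
  by apply/le_anti; rewrite Et E0.
have [rt|/ltW tr] := leP r t.
  apply: (done (- L)); apply: Gle => // y.
  by rewrite mulNr subr_le0 (le_trans (ler_norm _)).
apply: (done L); apply: Gge => // y.
by have := LE y; rewrite ler_norml => /andP[+ _]; rewrite -lerBlDr sub0r.
Qed.

(** Gronwall's inequality for the sum of squares of one column of [Y]. *)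
Lemma linear_ode_eq0 (R : realType) (n q : nat) (B : R -> 'M[R]_n)
    (Y : R -> 'M[R]_(n, q)) (r : R) :
  mx_bounded setT B -> (forall t : R, is_derive t 1 Y (B t *m Y t)) ->
  Y r = 0 -> forall t, Y t = 0.
Proof.
move=> [c Bc] dY Yr t; apply/matrixP => i k; rewrite mxE.
pose E s := \sum_i Y s i k ^+ 2.
pose E' s := \sum_i 2 * (Y s i k * \sum_j B s i j * Y s j k).
have dE (s : R) : is_derive s (1 : R) E (E' s).
  have /is_derive_mxP dYs := dY s.
  have := @is_derive_sum _ _ _ n (fun i s => Y s i k ^+ 2) s 1
    (fun i => 2 * (Y s i k * \sum_j B s i j * Y s j k)).
  have -> : \sum_(i < n) (fun s => Y s i k ^+ 2) = E.
    by apply/funext => x; rewrite fct_sumE.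
  apply=> j; have := is_deriveX 2 (dYs j k).
  have -> // : (2%:R * Y s j k ^+ 1) *: (B s *m Y s) j k =
    2 * (Y s j k * \sum_j0 B s j j0 * Y s j0 k).
  by rewrite mxE expr1 /GRing.scale/= mulrA.
have E0 s : 0 <= E s by apply: sumr_ge0 => j _; exact: sqr_ge0.
(* Each cross term is estimated by [2 x y <= x ^+ 2 + y ^+ 2]; the double sum of the squares then
   contributes [n] copies of [E s] twice. *)
have EE' s : `|E' s| <= (2 * `|c| * n%:R) * E s.
  apply: (@le_trans _ _ (\sum_i \sum_j `|c| * (Y s i k ^+ 2 + Y s j k ^+ 2))).
    apply: le_trans (ler_norm_sum _ _ _) _; apply: ler_sum => a _.
    rewrite mulr_sumr mulr_sumr; apply: le_trans (ler_norm_sum _ _ _) _.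
    apply: ler_sum => b _.
    have := le_trans (Bc s I a b) (ler_norm c).
    rewrite !normrM (ger0_norm (ler0n _ _)).
    rewrite -(real_normK (num_real (Y s a k))) -(real_normK (num_real (Y s b k))).
    move: (normr_ge0 (Y s a k)) (normr_ge0 (Y s b k)) (normr_ge0 (B s a b)).
    move: `|Y s a k| `|Y s b k| `|B s a b| `|c| => x y z d x0 y0 z0 zd.
    apply: (@le_trans _ _ (d * (2 * (x * y)))).
      have -> : 2 * (x * (z * y)) = z * (2 * (x * y)) by ring.
      by apply: ler_wpM2r => //; rewrite !mulr_ge0.
    apply: ler_wpM2l; first exact: le_trans z0 zd.
    rewrite -subr_ge0; have -> : x ^+ 2 + y ^+ 2 - 2 * (x * y) = (x - y) ^+ 2 by ring.
    exact: sqr_ge0.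
  rewrite le_eqVlt; apply/predU1P; left.
  under eq_bigr do rewrite -mulr_sumr big_split/= sumr_const card_ord.
  rewrite -mulr_sumr big_split/= sumr_const card_ord -/(E s) sumrMnl -/(E s).
  by rewrite -mulr_natr; ring.
have Er : E r = 0.
  by rewrite /E big1// => j _; rewrite Yr mxE expr0n.
have /eqP := gronwall_eq0 dE E0 EE' Er t.
rewrite psumr_eq0; last by move=> j _; exact: sqr_ge0.
by move=> /allP/(_ i (mem_index_enum _))/=; rewrite sqrf_eq0 => /eqP.
Qed.

Section transition.
Variables (R : realType) (n : nat) (B : R -> 'M[R]_n) (U : R -> R -> 'M[R]_n).
Hypotheses (bB : mx_bounded setT B) (hU : transition_matrix B U).

(** As functions of [t] both sides solve the same linear equation, and they agree at [t = s]. *)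
Lemma transition_matrix_comp (t s r : R) : U t s *m U s r = U t r.
Proof.
apply/eqP; rewrite -subr_eq0; apply/eqP.
apply: (linear_ode_eq0 (Y := fun t => U t s *m U s r - U t r) (r := s)) bB _ _ _.
  move=> x; have [_ /(_ x) dUs] := hU s; have [_ /(_ x) dUr] := hU r.
  have dc : is_derive x 1 (fun=> U s r) 0 by exact: is_derive_cst.
  have := is_deriveB (is_derive_mulmx dUs dc) dUr.
  by rewrite mulmx0 addr0 -mulmxA -mulmxBr.
by have [-> _] := hU s; rewrite mul1mx subrr.
Qed.

Lemma transition_matrixK (t s : R) : U t s *m U s t = 1%:M.
Proof. by rewrite transition_matrix_comp; have [-> _] := hU t. Qed.

Lemma invmx_transition_matrix (t s : R) : invmx (U s t) = U t s.
Proof.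
have [ust _] := mulmx1_unit (transition_matrixK s t).
by rewrite -[RHS]mulmx1 -(mulmxV ust) mulmxA transition_matrixK mul1mx.
Qed.

(** In its second argument [U t] is the inverse of [U^~ t], so the derivative of an inverse applies
    and the factor [U s t *m U t s] cancels. *)
Lemma is_derive_transition_matrix_r (t s : R) :
  is_derive s 1 (U t) (- (U t s *m B s)).
Proof.
have E : U t = (fun r => invmx (U r t)).
  by apply/funext => r; rewrite invmx_transition_matrix.
have [_ /(_ s) dU] := hU t.
have uU r : U r t \in unitmx by have [] := mulmx1_unit (transition_matrixK r t).
rewrite {1}E; have := is_derive_invmx uU dU.
by rewrite invmx_transition_matrix -!mulmxA transition_matrixK mulmx1.
Qed.

End transition.

(** * Integrals from a base point, oriented integrals and vector-valued primitives *)

Lemma interval_integral_subr (R : realType) (h : R -> R) (a b c x y : R) :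
  a <= b -> b <= c -> interval_integral h a c x -> interval_integral h a b y ->
  interval_integral h b c (x - y).
Proof.
move=> ab bc [iac eac] hab.
have ibc : (@lebesgue_measure R).-integrable `[b, c] (fun s => (h s)%:E).
  by apply: integrableS iac => //; apply: subset_itvr; rewrite bnd_simp.
split=> //.
have [_] := interval_integral_cat ab bc hab (conj ibc erefl).
by rewrite eac => ->; rewrite addrC addKr.
Qed.

Lemma interval_integral_subl (R : realType) (h : R -> R) (a b c x y : R) :
  a <= b -> b <= c -> interval_integral h a c x -> interval_integral h b c y ->
  interval_integral h a b (x - y).
Proof.
move=> ab bc [iac eac] hbc.
have iab : (@lebesgue_measure R).-integrable `[a, b] (fun s => (h s)%:E).
  by apply: integrableS iac => //; apply: subset_itvl; rewrite bnd_simp.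
split=> //.
have [_] := interval_integral_cat ab bc (conj iab erefl) hbc.
by rewrite eac => ->; rewrite addrK.
Qed.

(** The integral equation only speaks of intervals with end [t0]; any other interval is a sum or a
    difference of two of these, according to the position of [t0]. *)
Lemma has_primitive_based (R : realType) (h W : R -> R) (t0 : R) :
  (forall t, t0 <= t -> interval_integral h t0 t (W t - W t0)) ->
  (forall t, t <= t0 -> interval_integral h t t0 (W t0 - W t)) ->
  has_primitive h W.
Proof.
move=> hr hl a b ab.
have [t0a|/ltW at0] := leP t0 a.
  have -> : W b - W a = W b - W t0 - (W a - W t0) by ring.
  exact: interval_integral_subr t0a ab (hr _ (le_trans t0a ab)) (hr _ t0a).
have [t0b|/ltW bt0] := leP t0 b.
  have -> : W b - W a = W t0 - W a + (W b - W t0) by ring.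
  exact: interval_integral_cat at0 t0b (hl _ at0) (hr _ t0b).
have -> : W b - W a = W t0 - W a - (W t0 - W b) by ring.
exact: interval_integral_subl ab bt0 (hl _ at0) (hl _ bt0).
Qed.

Definition vhas_primitive (R : realType) (n : nat) (h W : R -> 'cV[R]_n) : Prop :=
  forall i, has_primitive (fun s => h s i 0) (fun s => W s i 0).

Lemma vhas_primitive_oriented (R : realType) (n : nat) (h W : R -> 'cV[R]_n)
    (a b : R) :
  vhas_primitive h W ->
  vintegrable `[Num.min a b, Num.max a b] h /\ oriented_integral a b h = W b - W a.
Proof.
move=> hW; have mM : Num.min a b <= Num.max a b by rewrite ge_min !le_max lexx.
split=> [i|]; first by have [] := hW i _ _ mM.
rewrite /oriented_integral; case: leP => [ab|/ltW ba]; apply/matrixP => i j;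
  rewrite ord1 !mxE; first by have [_ ->] := hW i a b ab.
by have [_ ->] := hW i b a ba; rewrite opprB.
Qed.

Lemma oriented_vhas_primitive (R : realType) (n : nat) (h W : R -> 'cV[R]_n)
    (t0 : R) :
  (forall t, vintegrable `[Num.min t0 t, Num.max t0 t] h) ->
  (forall t, oriented_integral t0 t h = W t - W t0) ->
  vhas_primitive h W.
Proof.
move=> ih eh i; apply: has_primitive_based (t0) _ _ => t tt; split.
- by have := ih t i; rewrite min_l ?max_r.
- have /matrixP/(_ i 0) := eh t.
  by rewrite /oriented_integral tt !mxE.
- by have := ih t i; rewrite min_r ?max_l.
- have /matrixP/(_ i 0) := eh t; rewrite /oriented_integral.
  case: leP => [t0t|_]; last first.
    by rewrite !mxE => /eqP; rewrite eqr_oppLR opprB => /eqP.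
  (* At [t = t0] the oriented integral takes its [a <= b] branch, and both sides vanish. *)
  have -> : t = t0 by apply/le_anti; rewrite tt t0t.
  by rewrite !mxE => ->.
Qed.

(** This allows a transition matrix to be moved under the integral, where it turns a kernel
    depending on [t] into one based at the fixed [t0]. *)
Lemma vintegral_mulmx (R : realType) (m n : nat) (D : set R) (C : 'M[R]_(m, n))
    (h : R -> 'cV[R]_n) :
  measurable D -> vintegrable D h ->
  vintegrable D (fun s => C *m h s) /\
  vintegral D (fun s => C *m h s) = C *m vintegral D h.
Proof.
move=> mD ih.
have iC i j : (@lebesgue_measure R).-integrable D (EFin \o (fun s => C i j * h s j 0)).
  rewrite /comp; under eq_fun do rewrite EFinM.
  exact: integrableZl.
have E i : (fun s => ((C *m h s) i 0)%:E) =
    (fun s => (\sum_(j < n) (C i j * h s j 0)%:E)%E).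
  by apply/funext => s; rewrite mxE sumEFin.
split=> [i|].
  by rewrite E; apply: integrable_sum => // j _; exact: iC.
apply/matrixP => i k; rewrite !mxE /Rintegral E.
rewrite integral_sum//; last by move=> j; exact: iC.
rewrite -sum_fine; last by move=> j _; apply: integrable_fin_num => //; exact: iC.
by apply: eq_bigr => j _; rewrite ?mxE -RintegralZl//; exact: ih.
Qed.

Lemma oriented_integral_mulmx (R : realType) (m n : nat) (a b : R)
    (C : 'M[R]_(m, n)) (h : R -> 'cV[R]_n) :
  vintegrable `[Num.min a b, Num.max a b] h ->
  oriented_integral a b (fun s => C *m h s) = C *m oriented_integral a b h.
Proof.
move=> ih; rewrite /oriented_integral; move: ih; case: leP => [ab|ba] ih.
  by have [//|_ ->] := vintegral_mulmx C _ ih.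
by have [//|_ ->] := vintegral_mulmx C _ ih; rewrite mulmxN.
Qed.

Lemma lipschitz_continuous_diag (R : realType) (m n : nat)
    (f : R -> 'cV[R]_m -> 'cV[R]_n) (l : R) (y : R -> 'cV[R]_m) :
  (forall x, continuous (f^~ x)) ->
  (forall t x1 x2, enorm (f t x1 - f t x2) <= l * enorm (x1 - x2)) ->
  continuous y -> continuous (fun t => f t (y t)).
Proof.
move=> cf lf cy t.
have -> : (fun s => f s (y s)) = (fun s => f s (y t) + (f s (y s) - f s (y t))).
  by apply/funext => s; rewrite addrC subrK.
rewrite /continuous_at subrr; apply: cvgD; first exact: cf.
apply/cvg_mxP => i j; rewrite mxE ord1.
pose psi s := `|l| * \sum_k `|y s k 0 - y t k 0|.
have psi0 : psi s @[s --> t] --> 0.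
  rewrite -[X in _ --> X](mulr0 `|l|); apply: cvgM; first exact: cvg_cst.
  rewrite [X in _ --> X](_ : 0 = \sum_(k < m) `|y t k 0 - y t k 0|); last first.
    by rewrite big1// => k _; rewrite subrr normr0.
  apply: cvg_big => [|k _]; first exact: add_continuous.
  apply: cvg_norm; apply: cvgB; last exact: cvg_cst.
  by have /cvg_mxP := cy t; apply.
apply: (squeeze_cvgr (f := fun s => - psi s) (h := psi)) => //; last first.
  by rewrite -[X in _ --> X]oppr0; exact: cvgN.
near=> s; rewrite -ler_norml.
apply: le_trans (normr_le_enorm _ i) _; apply: le_trans (lf _ _ _) _.
apply: (@le_trans _ _ (`|l| * enorm (y s - y t))).
  by apply: ler_wpM2r; [exact: sqrtr_ge0|exact: ler_norm].
apply: ler_wpM2l => //; apply: le_trans (enorm_le_sum _) _.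
by apply: ler_sum => k _; rewrite !mxE.
Unshelve. all: by end_near. Qed.

(** * Variation of constants with a piecewise continuous forcing term *)

Section piecewise_linear_ode.
Variables (R : realType) (n : nat) (theta : R) (th : int -> R).
Variables (B : R -> 'M[R]_n) (U : R -> R -> 'M[R]_n).
Variables (x G : R -> 'cV[R]_n) (Phi : int -> R -> 'cV[R]_n).
Hypotheses (hth : switching_sequence theta th).
Hypotheses (bB : mx_bounded setT B) (hU : transition_matrix B U).

Let continuous_U (t : R) : continuous (U t).
Proof. by move=> s; exact: is_derive_mx_continuous (is_derive_transition_matrix_r bB hU t s). Qed.

Let continuous_U_l (s : R) : continuous (U^~ s).
Proof. by move=> t; have [_ /(_ t)] := hU s; exact: is_derive_mx_continuous. Qed.

Lemma variation_of_constants :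
  continuous x -> (forall i, continuous (Phi i)) ->
  (forall i t, th i <= t < th (i + 1) -> G t = Phi i t) ->
  (forall i t, th i < t < th (i + 1) -> is_derive t 1 x (B t *m x t + G t)) ->
  forall t, vhas_primitive (fun s => U t s *m G s) (fun s => U t s *m x s).
Proof.
move=> cx cPhi GPhi dx t j.
apply: (piecewise_has_primitive (phi := fun i s => (U t s *m Phi i s) j 0) hth).
- by move=> s; apply: (cvg_mxP _ _ _).1; apply: cvg_mulmx; [exact: continuous_U|exact: cx].
- move=> i s; apply: (cvg_mxP _ _ _).1.
  by apply: cvg_mulmx; [exact: continuous_U|exact: cPhi].
- by move=> i s; rewrite in_itv/= => sI; rewrite (GPhi i s sI).
- move=> i s sI.
  have := is_derive_mulmx (is_derive_transition_matrix_r bB hU t s) (dx i s sI).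
  have sI' : th i <= s < th (i + 1) by case/andP: sI => /ltW-> ->.
  (* The terms with [B] cancel in the product rule and leave [U t s *m G s]. *)
  rewrite mulNmx mulmxDr -mulmxA addKr (GPhi i s sI').
  by move/is_derive_mxP; apply.
Qed.

Variable t0 : R.
Hypothesis hW : vhas_primitive (fun s => U t0 s *m G s) (fun s => U t0 s *m x s).

(** Recovers [x] from the primitive, so that regularity of the primitive passes to [x]. *)
Let xE : x = (fun t => U t t0 *m (U t0 t *m x t)).
Proof.
by apply/funext => t; rewrite mulmxA (transition_matrixK bB hU) mul1mx.
Qed.

Let continuous_W : continuous (fun s => U t0 s *m x s).
Proof.
move=> s; apply/cvg_mxP => i j; rewrite ord1.
exact: has_primitive_continuous (hW i) s.
Qed.

Lemma vhas_primitive_continuous : continuous x.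
Proof.
move=> t; have := cvg_mulmx _ (@continuous_U_l t0 t) (@continuous_W t).
by rewrite -xE mulmxA (transition_matrixK bB hU) mul1mx; apply.
Qed.

Hypothesis cPhi : forall i, continuous (Phi i).
Hypothesis GPhi : forall i t, th i <= t < th (i + 1) -> G t = Phi i t.

Let cH i j : continuous (fun s => (U t0 s *m Phi i s) j 0).
Proof.
move=> s; apply: (cvg_mxP _ _ _).1.
by apply: cvg_mulmx; [exact: continuous_U|exact: cPhi].
Qed.

Let HE i j : {in `[th i, th (i + 1)[, (fun s => (U t0 s *m G s) j 0) =1
  (fun s => (U t0 s *m Phi i s) j 0)}.
Proof. by move=> s; rewrite in_itv/= => sI; rewrite (GPhi sI). Qed.

(** Product rule in [xE]: differentiating [U t t0] produces [B t *m x t], and differentiating the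
    primitive produces [G t] since [U t t0] and [U t0 t] are inverse. *)
Lemma vhas_primitive_is_derive (i : int) (t : R) :
  th i < t < th (i + 1) -> is_derive t 1 x (B t *m x t + G t).
Proof.
move=> tI.
have dW : is_derive t 1 (fun s => U t0 s *m x s) (U t0 t *m Phi i t).
  apply/is_derive_mxP => j k; rewrite ord1.
  exact: (has_primitive_derive (hW j) (@cH i j) (@HE i j) tI).
have [_ /(_ t) dU] := hU t0.
have := is_derive_mulmx dU dW; rewrite -xE.
have tI' : th i <= t < th (i + 1) by case/andP: tI => /ltW-> ->.
by rewrite -mulmxA !mulmxA -(mulmxA (B t)) (transition_matrixK bB hU) mulmx1
  mul1mx -(GPhi tI').
Qed.

(** The same product rule along [0^'+]: at a switching time the primitive supplies a right
    derivative and [U^~ t0] a two-sided one. *)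
Lemma vhas_primitive_has_right_derivative (i : int) :
  has_right_derivative x (th i) (B (th i) *m x (th i) + G (th i)).
Proof.
have [mono _ _] := hth.
have iS : th i < th (i + 1) by apply: mono; rewrite ltrDl.
have dW : diff_quot (fun s => U t0 s *m x s) (th i) @ 0^'+
    --> U t0 (th i) *m Phi i (th i).
  apply/cvg_mxP => j k; rewrite ord1.
  have := has_primitive_right_derive (hW j) (@cH i j) (@HE i j) iS.
  by apply: cvg_trans; apply: near_eq_cvg; near=> e; rewrite /diff_quot !mxE.
have [_ /(_ (th i)) /is_derive_diff_quot dU] := hU t0.
have := diff_quot_mulmx _ _ (@continuous_W (th i)) (cvg_dnbhs_at_right dU) dW.
rewrite -xE !mulmxA -(mulmxA (B _)) (transition_matrixK bB hU) mulmx1 mul1mx.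
rewrite -(@GPhi i) ?lexx ?iS//; apply; exact: cvg_within.
Unshelve. all: by end_near. Qed.

End piecewise_linear_ode.

(** * The improper integral equation of the unstable component *)

Section backward_dichotomy.
Variables (R : realType) (n : nat) (B : R -> 'M[R]_n) (V : R -> R -> 'M[R]_n).
Variables (x G : R -> 'cV[R]_n) (K sigma : R).
Hypotheses (bB : mx_bounded setT B) (hV : transition_matrix B V).

(** After multiplication by [V t0 t] the integrand is the same for all [t], so the difference of two
    half-line integrals is the integral over the interval in between. *)
Lemma improper_vhas_primitive (t0 : R) :
  (forall t, vintegrable `[t, +oo[ (fun s => V t s *m G s)) ->
  (forall t, x t = - vintegral `[t, +oo[ (fun s => V t s *m G s)) ->
  vhas_primitive (fun s => V t0 s *m G s) (fun s => V t0 s *m x s).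
Proof.
move=> iG xG.
have E t : (fun s => V t0 t *m (V t s *m G s)) = (fun s => V t0 s *m G s).
  by apply/funext => s; rewrite mulmxA (transition_matrix_comp bB hV).
have VG t : vintegrable `[t, +oo[ (fun s => V t0 s *m G s) /\
    V t0 t *m x t = - vintegral `[t, +oo[ (fun s => V t0 s *m G s).
  have [//|] := vintegral_mulmx (V t0 t) _ (iG t).
  by rewrite E => i0 ->; rewrite xG mulmxN.
move=> i a b ab; have [ia ea] := VG a; have [ib eb] := VG b.
have iab : (@lebesgue_measure R).-integrable `[a, b]
    (fun s => ((V t0 s *m G s) i 0)%:E).
  by apply: integrableS (ia i) => //; apply: subset_itvl; rewrite bnd_simp.
split=> //; rewrite ea eb !mxE opprK addrC.
have /= := @Rintegral_itvB _ _ (BLeft a) +oo%O b (ia i).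
rewrite !bnd_simp => /(_ ab isT).
rewrite Rintegral_itv_obnd_cbnd; last first.
  by apply: integrableS (ib i) => //; apply: subset_itvr; rewrite bnd_simp.
by move=> <-; ring.
Qed.

Hypotheses (sigma_gt0 : 0 < sigma)
  (V_bound : forall t s : R, t <= s ->
     opnorm (V t s) <= K * expR (- sigma * (s - t))).

(** Used twice: with the forcing term to control the tail of the integral, and with the solution to
    make the boundary term at infinity disappear. *)
Lemma backward_dichotomy_bound (y : R -> 'cV[R]_n) (T t : R) :
  mx_bounded `[T, +oo[ y ->
  exists C, forall s, T <= s -> t <= s -> forall i,
    `|(V t s *m y s) i 0| <= C * expR (- sigma * (s - t)).
Proof.
move=> [c yc]; exists (\sum_(j < n) K * c) => s Ts ts i.
rewrite mxE mulr_suml; apply: le_trans (ler_norm_sum _ _ _) _.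
apply: ler_sum => j _; rewrite normrM mulrAC; apply: ler_pM => //.
  exact: le_trans (normr_le_opnorm _ _ _) (V_bound ts).
by apply: yc; rewrite /= in_itv/= andbT.
Qed.

Lemma vhas_primitive_improper (T t : R) :
  mx_bounded `[T, +oo[ G -> mx_bounded `[T, +oo[ x ->
  vhas_primitive (fun s => V t s *m G s) (fun s => V t s *m x s) ->
  vintegrable `[t, +oo[ (fun s => V t s *m G s) /\
  x t = - vintegral `[t, +oo[ (fun s => V t s *m G s).
Proof.
move=> bG bx hW.
have [C GC] := backward_dichotomy_bound t bG.
have [D xD] := backward_dichotomy_bound t bx.
pose h i s := (V t s *m G s) i 0.
(* The bounds on [G] and [x] start at [T] and the one on [V t s] at [s = t], so the cut [S] lies
   beyond both. *)
have tail i S : Num.max T t <= S ->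
    (@lebesgue_measure R).-integrable `[S, +oo[ (fun s => (h i s)%:E) /\
    `|\int[@lebesgue_measure R]_(s in `[S, +oo[) h i s|
      <= C / sigma * expR (- sigma * (S - t)).
  rewrite ge_max => /andP[TS tS].
  apply: Rintegral_exponential_tail => // [b|s Ss]; last first.
    by apply: GC; [exact: le_trans Ss|exact: le_trans Ss].
  have [Sb|/ltW bS] := leP S b; first by have [] := hW i S b Sb.
  have [iSS _] := interval_integral1 (h i) S.
  apply: integrableS iSS => //; apply: subset_itvl; by rewrite bnd_simp.
have full i S : Num.max T t <= S ->
    (@lebesgue_measure R).-integrable `[t, +oo[ (fun s => (h i s)%:E) /\
    \int[@lebesgue_measure R]_(s in `[t, +oo[) h i s =
      (V t S *m x S) i 0 - x t i 0 +
      \int[@lebesgue_measure R]_(s in `[S, +oo[) h i s.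
  move=> mS; have [iS _] := tail i S mS.
  have tS : t <= S by move: mS; rewrite ge_max => /andP[].
  have [itS etS] := hW i t S tS.
  have it : (@lebesgue_measure R).-integrable `[t, +oo[ (fun s => (h i s)%:E).
    have -> : `[t, +oo[%classic = `[t, S]%classic `|` `[S, +oo[%classic :> set R.
      apply/seteqP; split=> s /=; rewrite !in_itv/= !andbT.
        by move=> ->; exact/orP/le_total.
      by case=> [/andP[]//|]; exact: le_trans.
    exact: integrable_setU.
  split=> //.
  have /= := @Rintegral_itvB _ _ (BLeft t) +oo%O S it.
  rewrite !bnd_simp => /(_ tS isT).
  rewrite Rintegral_itv_obnd_cbnd; last first.
    by apply: integrableS iS => //; apply: subset_itvr; rewrite bnd_simp.
  have [Vt _] := hV t.
  by move=> <-; rewrite etS Vt mul1mx; ring.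
split=> [i|]; first by have [] := full i _ (lexx _).
apply/matrixP => i j; rewrite ord1 !mxE; apply/eqP; rewrite -subr_eq0 opprK -normr_le0.
set c := \int[_]_(_ in _) _.
have lim0 : (D + C / sigma) * expR (- sigma * (S - t)) @[S --> +oo] --> 0.
  rewrite -[X in _ --> X](mulr0 (D + C / sigma)).
  by apply: cvgM; [exact: cvg_cst|exact: cvg_exponential_decay].
(* The left side does not depend on [S]; it is bounded by the boundary term plus the tail beyond
   [S], which tend to zero, so it vanishes. *)
apply: (ler_cvg_to (cvg_cst `|x t i 0 + c|) lim0); near=> S.
have mS : Num.max T t <= S.
  near: S; apply: nbhs_pinfty_ge; exact: num_real.
have [_] := full i S mS; rewrite -/c => ->.
have -> : x t i 0 + ((V t S *m x S) i 0 - x t i 0 +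
    \int[@lebesgue_measure R]_(s in `[S, +oo[) h i s) =
  (V t S *m x S) i 0 + \int[@lebesgue_measure R]_(s in `[S, +oo[) h i s by ring.
have [_ tS] := tail i S mS.
rewrite (le_trans (ler_normD _ _))// mulrDl lerD//.
by move: mS; rewrite ge_max => /andP[TS tS']; exact: xD.
Unshelve. all: by end_near. Qed.

End backward_dichotomy.

(** * Bounds for the nonlinearity and the delay, and continuity of blocks *)

Lemma enorm0 (R : realType) (n : nat) : enorm (0 : 'cV[R]_n) = 0.
Proof.
by rewrite /enorm big1 ?sqrtr0// => i _; rewrite mxE expr0n.
Qed.

Lemma lipschitz_mx_bounded (R : realType) (n : nat) (D : set R)
    (f : R -> 'cV[R]_n -> 'cV[R]_n -> 'cV[R]_n) (l : R) (y w : R -> 'cV[R]_n) :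
  (forall t, f t 0 0 = 0) ->
  (forall t y1 w1 y2 w2,
    enorm (f t y1 w1 - f t y2 w2) <= l * (enorm (y1 - y2) + enorm (w1 - w2))) ->
  mx_bounded D y -> mx_bounded D w -> mx_bounded D (fun t => f t (y t) (w t)).
Proof.
move=> f0 lf [a ya] [b wb].
exists (`|l| * (\sum_(i < n) a + \sum_(i < n) b)) => t Dt i j; rewrite ord1.
apply: le_trans (normr_le_enorm _ i) _.
(* Comparison with the zero arguments, where [f] vanishes. *)
have := lf t (y t) (w t) 0 0; rewrite f0 !subr0 => /le_trans; apply.
apply: (@le_trans _ _ (`|l| * (enorm (y t) + enorm (w t)))).
  by apply: ler_wpM2r; [rewrite addr_ge0// sqrtr_ge0|exact: ler_norm].
apply: ler_wpM2l => //; apply: lerD;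
  apply: le_trans (enorm_le_sum _) _; apply: ler_sum => k _.
  exact: ya.
exact: wb.
Qed.

Lemma piecewise_argument_ge (R : realType) (theta : R) (th : int -> R)
    (beta : R -> R) (t : R) :
  switching_sequence theta th -> piecewise_argument th beta ->
  t - theta <= beta t.
Proof.
move=> hth hbeta; have [i tI] := switching_sequence_locate t hth.
have [_ _ /(_ i) gap] := hth.
rewrite (hbeta i t tI); case/andP: tI => _ /ltW ti.
by rewrite lerBlDr (le_trans ti)// -lerBlDl.
Qed.

Lemma continuous_col_mx (R : realType) (k p : nat) (u : R -> 'cV[R]_k)
    (v : R -> 'cV[R]_p) :
  continuous u -> continuous v -> continuous (fun t => col_mx (u t) (v t)).
Proof.
move=> cu cv t; apply/cvg_mxP => i j; rewrite mxE.
under eq_cvg do rewrite mxE.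
by case: (fintype.split i) => a; [move: (cu t)|move: (cv t)] => /cvg_mxP; apply.
Qed.

Lemma continuous_usubmx (R : realType) (k p : nat) (x : R -> 'cV[R]_(k + p)) :
  continuous x -> continuous (fun t => usubmx (x t)).
Proof.
move=> cx t; apply/cvg_mxP => i j; rewrite mxE.
under eq_cvg do rewrite mxE.
by move: (cx t) => /cvg_mxP; apply.
Qed.

Lemma continuous_dsubmx (R : realType) (k p : nat) (x : R -> 'cV[R]_(k + p)) :
  continuous x -> continuous (fun t => dsubmx (x t)).
Proof.
move=> cx t; apply/cvg_mxP => i j; rewrite mxE.
under eq_cvg do rewrite mxE.
by move: (cx t) => /cvg_mxP; apply.
Qed.

(** * Equivalence of the differential and the integral system *)

Theorem lemma2p1 (R : realType) (k p : nat)
    (theta : R) (th : int -> R) (beta : R -> R)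
    (A : R -> 'M[R]_(k + p)) (mu : R)
    (f : R -> 'cV[R]_(k + p) -> 'cV[R]_(k + p) -> 'cV[R]_(k + p)) (l : R)
    (X : R -> 'M[R]_(k + p)) (P : 'M[R]_(k + p)) (K sigma : R)
    (Q : R -> 'M[R]_(k + p)) (Bp : R -> 'M[R]_k) (Bm : R -> 'M[R]_p)
    (U : R -> R -> 'M[R]_k) (V : R -> R -> 'M[R]_p)
    (M m : R) (N alpha t0 : R)
    (theta_gt0 : 0 < theta)
    (hth : switching_sequence theta th)
    (hbeta : piecewise_argument th beta)
    (A_cont : continuous A)
    (A_bounded : has_ubound (range (fun t : R => opnorm (A t))))
    (mu_def : mu = sup (range (fun t : R => opnorm (A t))))
    (f_cont : forall y w : 'cV[R]_(k + p), continuous (fun t : R => f t y w))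
    (f0 : forall t : R, f t 0 0 = 0)
    (f_lip : forall (t : R) (y1 w1 y2 w2 : 'cV[R]_(k + p)),
       enorm (f t y1 w1 - f t y2 w2) <= l * (enorm (y1 - y2) + enorm (w1 - w2)))
    (K_gt0 : 0 < K) (sigma_gt0 : 0 < sigma)
    (dichotomy : exponential_dichotomy A X P K sigma)
    (k_rank : k = \rank P)
    (M_def : M = expR (mu * theta))
    (m_def : m = expR (- mu * theta))
    (small : l * M * theta * (1 + M * (1 + l * theta) * expR (M * l * theta)) < m)
    (Q_lyapunov : lyapunov_matrix Q)
    (B_def : forall t : R,
       block_mx (Bp t) 0 0 (Bm t)
       = invmx (Q t) *m A t *m Q t - invmx (Q t) *m derive1 Q t)
    (U_transition : transition_matrix Bp U)
    (V_transition : transition_matrix Bm V)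
    (U_bound : forall t s : R, s <= t ->
       opnorm (U t s) <= K * expR (- sigma * (t - s)))
    (V_bound : forall t s : R, t <= s ->
       opnorm (V t s) <= K * expR (- sigma * (s - t)))
    (N_gt0 : 0 < N) (alpha_bound : 0 < alpha < sigma)
    (u : R -> 'cV[R]_k) (v : R -> 'cV[R]_p)
    (z_bound : forall t : R, t0 <= t ->
       enorm (col_mx (u t) (v t)) <= N * expR (- alpha * (t - t0))) :
  reduced_solution th beta Bp Bm (reduced_nonlinearity Q beta f) u v <->
  integral_solution beta U V (reduced_nonlinearity Q beta f) t0 u v.
Proof.
pose z t := col_mx (u t) (v t).
pose G t := reduced_nonlinearity Q beta f t (z t) (z (beta t)).
(* [G] with the delayed argument frozen at [th i]. It equals [G] on the [i]-th piece and is
   continuous on the whole line once [z] is. *)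
pose Phi i t := invmx (Q t) *m f t (Q t *m z t) (Q (th i) *m z (th i)).
have [dQ cQ' uQ [[cQ bQ] [cQ1 bQ1] [cQi bQi]]] := Q_lyapunov.
have {}bQ : mx_bounded setT Q by apply: (opnorm_mx_bounded (c := cQ)).
have {}bQ1 : mx_bounded setT (derive1 Q) by apply: (opnorm_mx_bounded (c := cQ1)).
have {}bQi : mx_bounded setT (fun t => invmx (Q t)).
  by apply: (opnorm_mx_bounded (c := cQi)).
have bA : mx_bounded setT A.
  apply: (opnorm_mx_bounded (c := mu)) => t _; rewrite mu_def.
  by apply: ub_le_sup => //; exists t.
(* The formula for the block matrix bounds both coefficients, which the uniqueness argument behind
   the transition identities requires. *)
have [cB bB] : mx_bounded setT (fun t => block_mx (Bp t) 0 0 (Bm t)).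
  have -> : (fun t => block_mx (Bp t) 0 0 (Bm t)) =
      (fun t => invmx (Q t) *m A t *m Q t - invmx (Q t) *m derive1 Q t).
    by apply/funext => t; exact: B_def.
  by apply: mx_boundedB; apply: mx_boundedM => //; exact: mx_boundedM.
have bBp : mx_bounded setT Bp.
  by exists cB => t I i j; have := bB t I (lshift p i) (lshift p j); rewrite block_mxEul.
have bBm : mx_bounded setT Bm.
  by exists cB => t I i j; have := bB t I (rshift k i) (rshift k j); rewrite block_mxEdr.
have cQ0 : continuous Q.
  by move=> t; apply/differentiable_continuous/derivable1_diffP; exact: dQ.
have cPhi : continuous z -> forall i, continuous (Phi i).
  move=> cz i t; apply: cvg_mulmx; first by apply: cvg_invmx => //; exact: cQ0.
  apply: (@lipschitz_continuous_diag _ _ _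
    (fun s x => f s x (Q (th i) *m z (th i))) l (fun s => Q s *m z s)).
  - by move=> x; exact: f_cont.
  - move=> s x1 x2; apply: le_trans (f_lip _ _ _ _ _) _.
    by rewrite subrr enorm0 addr0.
  - by move=> s; apply: cvg_mulmx; [exact: cQ0|exact: cz].
have GPhi i t : th i <= t < th (i + 1) -> G t = Phi i t.
  by move=> tI; rewrite /G /reduced_nonlinearity (hbeta i t tI).
have bz : mx_bounded `[t0, +oo[ z.
  exists N => t; rewrite /= in_itv/= andbT => t0t i j; rewrite ord1.
  apply: le_trans (normr_le_enorm _ i) _; apply: le_trans (z_bound t t0t) _.
  rewrite ler_piMr ?(ltW N_gt0)// expR_le1 mulNr oppr_le0 mulr_ge0 ?subr_ge0//.
  by case/andP: alpha_bound => /ltW.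
have bv : mx_bounded `[t0 + theta, +oo[ v.
  case: bz => c zc; exists c => t; rewrite /= in_itv/= andbT => tt i j.
  have := zc t _ (rshift k i) j; rewrite col_mxEd; apply.
  by rewrite /= in_itv/= andbT (le_trans _ tt)// lerDl ltW.
(* The bound on [z] starts at [t0] and the delay is at most [theta], so [z (beta t)] is under
   control from [t0 + theta] on. *)
have bG : mx_bounded `[t0 + theta, +oo[ G.
  have sub (q r : nat) (F : R -> 'M[R]_(q, r)) (D : set R) :
      mx_bounded setT F -> mx_bounded D F.
    by case=> c Fc; exists c => t _; exact: Fc.
  apply: mx_boundedM; first exact: sub.
  apply: (lipschitz_mx_bounded (l := l)) => //.
  - apply: mx_boundedM; first exact: sub.
    case: bz => c zc; exists c => t; rewrite /= in_itv/= andbT => tt.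
    by apply: zc; rewrite /= in_itv/= andbT (le_trans _ tt)// lerDl ltW.
  - apply: (mx_boundedM (F := fun t => Q (beta t)) (G := fun t => z (beta t))).
      by case: bQ => c Qc; exists c => t _; exact: Qc.
    case: bz => c zc; exists c => t; rewrite /= in_itv/= andbT => tt.
    apply: zc; rewrite /= in_itv/= andbT.
    by apply: le_trans (piecewise_argument_ge t hth hbeta); rewrite lerBrDr.
have bGm : mx_bounded `[t0 + theta, +oo[ (fun t => dsubmx (G t)).
  by case: bG => c Gc; exists c => t It i j; rewrite mxE; exact: Gc.
have PhiU i t (tI : th i <= t < th (i + 1)) : usubmx (G t) = usubmx (Phi i t).
  by rewrite (GPhi i).
have PhiD i t (tI : th i <= t < th (i + 1)) : dsubmx (G t) = dsubmx (Phi i t).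
  by rewrite (GPhi i).
split=> [[cu cv duv _]|sol].
- have cz : continuous z by exact: continuous_col_mx.
  have hu := variation_of_constants hth bBp U_transition cu
    (fun i => continuous_usubmx (cPhi cz i)) PhiU (fun i t tI => (duv i t tI).1).
  have hv := variation_of_constants hth bBm V_transition cv
    (fun i => continuous_dsubmx (cPhi cz i)) PhiD (fun i t tI => (duv i t tI).2).
  move=> t; have [iu eu] := vhas_primitive_oriented t0 t (hu t).
  have [iv ev] := vhas_primitive_improper V_transition sigma_gt0 V_bound bGm bv (hv t).
  (* The oriented integral equals [U t t *m u t - U t t0 *m u t0], with [U t t] the identity. *)
  split=> //; rewrite eu; have [-> _] := U_transition t.
  by rewrite mul1mx addrC subrK.
(* Multiplying the equation for [u] by [U t0 t] bases the kernel at [t0] and exhibits a primitive.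
   Continuity of [z] must come before that of [Phi i], on which differentiability rests. *)
- have hu : vhas_primitive (fun s => U t0 s *m usubmx (G s)) (fun s => U t0 s *m u s).
    have E t : (fun s => U t0 t *m (U t s *m usubmx (G s))) =
        (fun s => U t0 s *m usubmx (G s)).
      by apply/funext => s; rewrite mulmxA (transition_matrix_comp bBp U_transition).
    apply: (oriented_vhas_primitive (t0 := t0)) => t; have [iu eu _ _] := sol t.
      by have [//|] := vintegral_mulmx (U t0 t) _ iu; rewrite E.
    have := oriented_integral_mulmx (U t0 t) iu; rewrite E => ->.
    rewrite eu mulmxDr mulmxA (transition_matrix_comp bBp U_transition).
    by rewrite addrC addKr.
  have hv : vhas_primitive (fun s => V t0 s *m dsubmx (G s)) (fun s => V t0 s *m v s).
    by apply: (improper_vhas_primitive bBm V_transition) => t; have [] := sol t.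
  have cu := vhas_primitive_continuous bBp U_transition hu.
  have cv := vhas_primitive_continuous bBm V_transition hv.
  have cz : continuous z by exact: continuous_col_mx.
  have cPu i := continuous_usubmx (cPhi cz i).
  have cPd i := continuous_dsubmx (cPhi cz i).
  split=> //.
  + move=> i t tI; split.
      exact: (vhas_primitive_is_derive bBp U_transition hu cPu PhiU tI).
    exact: (vhas_primitive_is_derive bBm V_transition hv cPd PhiD tI).
  + move=> i; split.
      exact: (vhas_primitive_has_right_derivative hth bBp U_transition hu cPu PhiU).
    exact: (vhas_primitive_has_right_derivative hth bBm V_transition hv cPd PhiD).
Qed.
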